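(* Let $G$ and $H$ be finite nonempty connected graphs each having at least one edge, $f\colon G\to H$ a graph homomorphism, $v\in V(G)$, $w=f(v)$, $\Gamma=\pi_1^2(G,v)$, universal 2-coverings $p_G\colon(\tilde G,\tilde v)\to(G,v)$, $p_H\colon(\tilde H,\tilde w)\to(H,w)$, and $\tilde f$ the based lift of $f$. Let $\varpi\in\pi_1^2(H,w)$. Then the following are equivalent: (1) $\varpi\in\Pi(f,v)$; (2) the graph homomorphism $\varpi\tilde f\colon\tilde x\mapsto\varpi(\tilde f(\tilde x))$ belongs to $\mathrm{Hom}^\Gamma(\tilde G,\tilde H)_{\tilde f}$.
   Context: Graphs allow loops; $N(x)$ neighborhood, $N^2(x)=\bigcup_{y\in N(x)}N(y)$. $\pi_1^2(G,v)$: group of classes of closed walks at $v$ under the equivalence generated by (A) $(x_0,\dots,x_m)\sim(x_0,\dots,x_k,y,x_k,\dots,x_m)$, $y$ adjacent to $x_k$, and (B) equal-length walks differing in at most one position. A 2-covering map restricts to bijections $N(x)\to N(p(x))$, $N^2(x)\to N^2(p(x))$; the universal 2-covering is the connected based 2-covering with trivial 2-fundamental group. $\pi_1^2(H,w)$ acts on $\tilde H$: for $g=[\gamma]$ and a walk $\varphi$ from $\tilde w$ to $\tilde y$, $g\tilde y$ is the endpoint of the lift from $\tilde w$ of $\gamma\cdot(p_H\circ\varphi)$; analogously $\Gamma$ acts on $\tilde G$, and $\Gamma$ acts on $\tilde H$ via $f_*$; $\tilde f$ (the based homomorphism with $p_H\circ\tilde f=f\circ p_G$) is $\Gamma$-equivariant.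 Multi-homomorphisms $\eta\colon V(\tilde G)\to\mathcal{P}(V(\tilde H))\setminus\{\emptyset\}$ with $\eta(x)\times\eta(y)\subseteq E(\tilde H)$ for edges $(x,y)$, ordered by pointwise inclusion, topologized by the order complex; graph homomorphisms identified with singleton-valued ones. $\mathrm{Hom}^\Gamma(\tilde G,\tilde H)$: those $\eta$ with $\eta(g\tilde x)=f_*(g)\eta(\tilde x)$; subscript $\tilde f$ denotes the connected component containing $\tilde f$. $\times$-homotopy from $f$ to $f$: graph homomorphism $h\colon G\times I_n\to H$ ($I_n$: vertices $0,\dots,n$, $i\sim j$ iff $|i-j|\le1$; categorical product) with $h(x,0)=h(x,n)=f(x)$. For $v'\in N_G(v)$, the class of the closed walk $(h(v,0),h(v',0),h(v,1),\dots,h(v',n-1),h(v,n))$ in $\pi_1^2(H,w)$ is independent of $v'$ and is realized by $h$; $\Pi(f,v)$ is the subgroup of elements realized by some such $h$. *)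

(* Defs.v *)
From HB Require Import structures.
From Stdlib Require Import Relation_Operators.
From mathcomp Require Import all_boot all_order all_algebra generic_quotient.
From mathcomp Require Import boolp classical_sets functions cardinality.
From mathcomp Require Import fsbigop reals topology.

Set Implicit Arguments.
Unset Strict Implicit.
Unset Printing Implicit Defensive.

Import Order.TTheory GRing.Theory Num.Theory.
Import numFieldTopology.Exports.

Local Open Scope classical_set_scope.
Local Open Scope quotient_scope.

Record graph := Graph {
  vertex :> choiceType;
  adj : rel vertex;
  adj_sym : symmetric adj }.
Arguments adj {g}.

Definition nbhd (G : graph) (x : G) : set G := [set y | adj x y].

Definition nbhd2 (G : graph) (x : G) : set G := \bigcup_(y in nbhd x) nbhd y.

Definition edges (G : graph) : set (G * G) := [set e | adj e.1 e.2].

(* The walk (x0, x1, ..., xm) is encoded by its origin x0 and the list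
   [:: x1; ...; xm], as in path.v; its end point is last x0 [:: x1; ...; xm]. *)
Definition connected_graph (G : graph) :=
  forall x y : G, exists2 p, path adj x p & last x p = y.

Record hom (G H : graph) := Hom {
  hom_fun :> G -> H;
  hom_adj : forall x y, adj x y -> adj (hom_fun x) (hom_fun y) }.

Section TwoFundamentalGroup.
Variables (G : graph) (v : G).

Definition closed_walk (p : seq G) := path adj v p && (last v p == v).

Definition loop := {p : seq G | closed_walk p}.

Definition moveA (p q : seq G) := exists p1 p2 y,
  [/\ p = p1 ++ p2, adj (last v p1) y & q = p1 ++ [:: y, last v p1 & p2]].

(* As p and q are closed walks at v, they agree at position 0 anyway. *)
Definition moveB (p q : seq G) :=
  size p = size q /\ exists i, forall j, j != i -> nth v p j = nth v q j.

Definition move (p q : loop) := moveA (val p) (val q) \/ moveB (val p) (val q).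

Definition homotopic : rel loop :=
  fun p q => `[< clos_refl_sym_trans loop move p q >].

Lemma homotopic_refl : reflexive homotopic.
Proof. by move=> p; apply/asboolP/rst_refl. Qed.

Lemma homotopic_sym : symmetric homotopic.
Proof. by move=> p q; apply/asboolP/asboolP => h; apply: rst_sym. Qed.

Lemma homotopic_trans : transitive homotopic.
Proof.
by move=> q p r /asboolP pq /asboolP qr; apply/asboolP; apply: rst_trans pq qr.
Qed.

Canonical homotopic_equiv :=
  EquivRel homotopic homotopic_refl homotopic_sym homotopic_trans.

Definition pi12 := {eq_quot homotopic}.
HB.instance Definition _ := EqQuotient.on pi12.
HB.instance Definition _ := Choice.on pi12.

Lemma homotopic_val (p q : loop) : val p = val q -> homotopic p q.
Proof. by move=> /val_inj ->; exact: homotopic_refl. Qed.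

Lemma move_homotopic (p q : loop) : move p q -> homotopic p q.
Proof. by move=> h; apply/asboolP/rst_step. Qed.

Lemma homotopic_map (f : loop -> loop) :
  (forall p q, move p q -> move (f p) (f q)) ->
  forall p q, homotopic p q -> homotopic (f p) (f q).
Proof.
move=> fm p q /asboolP; elim=> {p q} [p q /fm/move_homotopic//|p|p q _|p q r _].
- exact: homotopic_refl.
- by rewrite homotopic_sym.
- by move=> pq _; exact: homotopic_trans.
Qed.

Lemma closed_walk0 : closed_walk [::].
Proof. by rewrite /closed_walk /= eqxx. Qed.

Lemma closed_walk_cat (p q : seq G) :
  closed_walk p -> closed_walk q -> closed_walk (p ++ q).
Proof.
move=> /andP[pp /eqP lp] /andP[pq /eqP lq].
by rewrite /closed_walk cat_path last_cat lp pp pq lq eqxx.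
Qed.

Lemma closed_walk_rev (p : seq G) : closed_walk p -> closed_walk (rev (belast v p)).
Proof.
move=> /andP[pp /eqP lp]; rewrite /closed_walk -{1}lp rev_path.
rewrite (eq_path (e' := adj)) ?pp /=; last by move=> x y; rewrite adj_sym.
by case: p lp {pp} => [|x p] lp; rewrite /= ?eqxx// rev_cons last_rcons.
Qed.

Definition loop1 : loop := Sub [::] closed_walk0.

Definition loopM (p q : loop) : loop :=
  Sub (val p ++ val q) (closed_walk_cat (valP p) (valP q)).

Definition loopV (p : loop) : loop :=
  Sub (rev (belast v (val p))) (closed_walk_rev (valP p)).

Lemma moveMl (r p q : loop) : move p q -> move (loopM r p) (loopM r q).
Proof.
have /andP[_ /eqP lr] := valP r.
case=> [[p1 [p2 [y [ep ay eq]]]]|[spq [i hi]]]; [left|right].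
  exists (val r ++ p1), p2, y; rewrite /= ep eq !last_cat lr !catA.
  by split.
split; first by rewrite /= !size_cat spq.
exists (size (val r) + i) => j ji /=; rewrite !nth_cat.
case: ltnP => // rj; apply: hi; apply: contra ji => /eqP <-.
by rewrite subnKC.
Qed.

Lemma moveMr (r p q : loop) : move p q -> move (loopM p r) (loopM q r).
Proof.
case=> [[p1 [p2 [y [ep ay eq]]]]|[spq [i hi]]]; [left|right].
  by exists p1, (p2 ++ val r), y; rewrite /= ep eq -!catA; split.
split; first by rewrite /= !size_cat spq.
by exists i => j ji /=; rewrite !nth_cat spq; case: ifP => // _; apply: hi.
Qed.

Lemma nth_belast (p : seq G) j : j < size p -> nth v (belast v p) j = nth v (v :: p) j.
Proof.
by move=> jp; rewrite lastI nth_rcons size_belast jp.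
Qed.

Lemma moveV (p q : loop) : move p q -> move (loopV p) (loopV q).
Proof.
have /andP[_ /eqP lp] := valP p; have /andP[_ /eqP lq] := valP q.
case=> [[p1 [p2 [y [ep ay eq]]]]|[spq [i hi]]]; [left|right].
  set x := last v p1 in ay eq.
  have lx : last v (rev (belast x p2)) = x.
    move: lp; rewrite ep last_cat -/x; case: (p2) => [//|z s] _.
    by rewrite /= rev_cons last_rcons.
  exists (rev (belast x p2)), (rev (belast v p1)), y.
  rewrite lx /= ep eq !belast_cat !rev_cat -/x /=; split=> //.
  by rewrite !rev_cons -!cats1 -!catA.
split; first by rewrite /= !size_rev !size_belast.
exists (size (val p) - i.+2) => j ji /=.
have [jp|pj] := ltnP j (size (val p)); last first.
  by rewrite !nth_default ?size_rev ?size_belast -?spq.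
rewrite !nth_rev ?size_belast -?spq// !nth_belast ?rev_ord_proof -?spq //;
  try by rewrite ltn_subrL (leq_ltn_trans _ jp).
case E : (size (val p) - j.+1) => [//|k] /=; apply: hi.
apply: contra ji => /eqP <-; apply/eqP.
have := subnKC jp; rewrite E => <-.
by rewrite addSnnS addnK.
Qed.

Lemma loopMV (p : loop) : homotopic (loopM p (loopV p)) loop1.
Proof.
case: p => p cp.
suff H s : path adj v s -> forall l : loop, val l = s ++ rev (belast v s) ->
    homotopic l loop1.
  by apply: (H p) => //; case/andP: cp.
elim/last_ind: s => [_ l ls|s x IHs]; first exact: homotopic_val.
rewrite rcons_path => /andP[ps ax] l ls.
have {}ls : val l = s ++ [:: x, last v s & rev (belast v s)].
  by rewrite ls belast_rcons lastI rev_rcons cat_rcons.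
have cs : closed_walk (s ++ rev (belast v s)).
  have /andP[] := valP l; rewrite /= ls /closed_walk !cat_path !last_cat /=.
  by move=> /and4P[-> _ _ ->] ->.
have sl : homotopic (Sub _ cs) l.
  by apply: move_homotopic; left; exists s, (rev (belast v s)), x.
by rewrite homotopic_sym in sl; apply: homotopic_trans sl _; apply: IHs.
Qed.

Lemma loopVV (p : loop) : homotopic (loopV (loopV p)) p.
Proof.
apply: homotopic_val => /=; case: p => p /= /andP[_ /eqP].
case/lastP: p => [//|s x]; rewrite last_rcons => ->.
rewrite belast_rcons rev_cons belast_rcons rev_cons revK.
by case: s => [|y s].
Qed.

Lemma loopVM (p : loop) : homotopic (loopM (loopV p) p) loop1.
Proof.
have h : homotopic (loopM (loopV p) p) (loopM (loopV p) (loopV (loopV p))).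
  apply: homotopic_map; first exact: moveMl.
  by rewrite homotopic_sym loopVV.
exact: homotopic_trans h (loopMV _).
Qed.

Definition pi12_one : pi12 := \pi_pi12 loop1.
Definition pi12_mul (a b : pi12) : pi12 := \pi_pi12 (loopM (repr a) (repr b)).
Definition pi12_inv (a : pi12) : pi12 := \pi_pi12 (loopV (repr a)).

Lemma pi12_eqP (p q : loop) :
  reflect (\pi_pi12 p = \pi_pi12 q) (homotopic p q).
Proof. by apply: (iffP idP) => /eqmodP. Qed.

Lemma homotopic_repr (p : loop) : homotopic (repr (\pi_pi12 p)) p.
Proof. by apply/pi12_eqP; rewrite reprK. Qed.

Lemma pi12_mulE (p q : loop) :
  pi12_mul (\pi_pi12 p) (\pi_pi12 q) = \pi_pi12 (loopM p q).
Proof.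
apply/pi12_eqP; apply: (@homotopic_trans (loopM p (repr (\pi_pi12 q)))).
  by apply: (homotopic_map (@moveMr _)); exact: homotopic_repr.
by apply: (homotopic_map (@moveMl _)); exact: homotopic_repr.
Qed.

Lemma pi12_invE (p : loop) : pi12_inv (\pi_pi12 p) = \pi_pi12 (loopV p).
Proof. by apply/pi12_eqP/(homotopic_map moveV)/homotopic_repr. Qed.

Lemma pi12_mulA : associative pi12_mul.
Proof.
move=> a b c; rewrite -[a]reprK -[b]reprK -[c]reprK.
rewrite (pi12_mulE (repr b)) (pi12_mulE (repr a) (repr b)) !pi12_mulE.
by apply/pi12_eqP/homotopic_val; rewrite /= catA.
Qed.

Lemma pi12_mul1 : left_id pi12_one pi12_mul.
Proof.
by move=> a; rewrite -[a]reprK pi12_mulE; apply/pi12_eqP/homotopic_val.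
Qed.

Lemma pi12_1mul : right_id pi12_one pi12_mul.
Proof.
move=> a; rewrite -[a]reprK pi12_mulE; apply/pi12_eqP/homotopic_val.
by rewrite /= cats0.
Qed.

Lemma pi12_mulV : left_inverse pi12_one pi12_inv pi12_mul.
Proof.
move=> a; rewrite -[a]reprK pi12_invE pi12_mulE.
by apply/pi12_eqP/loopVM.
Qed.

Lemma pi12_Vmul : right_inverse pi12_one pi12_inv pi12_mul.
Proof.
move=> a; rewrite -[a]reprK pi12_invE pi12_mulE.
by apply/pi12_eqP/loopMV.
Qed.

HB.instance Definition _ := isGroup.Build pi12
  pi12_mulA pi12_mul1 pi12_1mul pi12_mulV pi12_Vmul.

End TwoFundamentalGroup.
Arguments pi12 : clear implicits.
Arguments pi12 {G} v.

Section InducedMap.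
Variables (G H : graph) (f : hom G H) (v : G).

Lemma closed_walk_map (p : seq G) :
  closed_walk v p -> closed_walk (f v) (map f p).
Proof.
move=> /andP[pp /eqP lp]; rewrite /closed_walk last_map lp eqxx andbT.
by rewrite path_map; apply: sub_path pp => x y; apply: hom_adj.
Qed.

Definition loop_map (p : loop v) : loop (f v) :=
  Sub (map f (val p)) (closed_walk_map (valP p)).

Definition pi12_map (g : pi12 v) : pi12 (f v) := \pi_(pi12 (f v)) (loop_map (repr g)).

Lemma pi12_mapE (p : loop v) :
  pi12_map (\pi_(pi12 v) p) = \pi_(pi12 (f v)) (loop_map p).
Proof.
apply/pi12_eqP; move: (homotopic_repr p).
move: (repr _) => q /asboolP.
elim=> {p q} [p q pq|p|p q _|p q r _].
- apply: move_homotopic; case: pq => [[p1 [p2 [y [ep ay eq]]]]|[spq [i hi]]].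
    left; exists (map f p1), (map f p2), (f y).
    by rewrite last_map hom_adj //= ep eq !map_cat.
  right; rewrite /moveB /= !size_map; split=> //; exists i => j ji.
  have [jp|pj] := ltnP j (size (val p)).
    by rewrite !(nth_map v) -?spq// hi.
  by rewrite !nth_default ?size_map -?spq.
- exact: homotopic_refl.
- by rewrite homotopic_sym.
- by move=> pq _; exact: homotopic_trans.
Qed.

End InducedMap.

Definition covering2 (tG G : graph) (p : hom tG G) := forall x : tG,
  set_bij (nbhd x) (nbhd (p x)) p /\ set_bij (nbhd2 x) (nbhd2 (p x)) p.

Definition universal_covering2 (tG : graph) (tv : tG) (G : graph) (v : G)
    (p : hom tG G) :=
  [/\ p tv = v, covering2 p, connected_graph tG
    & forall g : pi12 tv, g = 1%g].

(* z is the end point of the lift psi from tv of gamma . (p o phi), where gamma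
   represents g and phi is a walk from tv to x. *)
Definition is_act (tG : graph) (tv : tG) (G : graph) (v : G) (p : hom tG G)
    (g : pi12 v) (x z : tG) :=
  exists (gamma : loop v) (phi psi : seq tG),
  [/\ g = \pi_(pi12 v) gamma,
      path adj tv phi /\ last tv phi = x,
      path adj tv psi /\ map p psi = val gamma ++ map p phi
    & last tv psi = z].

(* When p is a universal 2-covering based at tv, there is exactly one z with
   is_act tv p g x z, and the default value x of xget is irrelevant. *)
Definition act (tG : graph) (tv : tG) (G : graph) (v : G) (p : hom tG G)
    (g : pi12 v) (x : tG) : tG :=
  xget x [set z | is_act tv p g x z].

Section OrderComplex.
Variables (R : realType) (T : choiceType) (le : T -> T -> Prop) (P : set T).

Definition is_chain (s : set T) :=
  s `<=` P /\ (forall x y, s x -> s y -> le x y \/ le y x).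

Local Open Scope ring_scope.

(* A point of the geometric realization of the order complex of P, given by
   its barycentric coordinates. *)
Record realization := Realization {
  coord :> T -> R;
  coord_ge0 : forall x, 0 <= coord x;
  coord_finite : finite_set [set x | coord x != 0];
  coord_chain : is_chain [set x | coord x != 0];
  coord_sum : \sum_(x \in [set: T]) coord x = 1 }.

HB.instance Definition _ := gen_eqMixin realization.
HB.instance Definition _ := gen_choiceMixin realization.

Definition closed_simplex (s : set T) : set realization :=
  [set t | [set x | coord t x != 0] `<=` s].

(* The coherent topology: U is open iff its trace on every closed simplex is
   open for the Euclidean topology, i.e. that of the coordinates. *)
Definition realization_open (U : set realization) :=
  forall s, finite_set s -> is_chain s ->
  exists2 V : set {ptws T -> R}, open V &
    closed_simplex s `&` U = closed_simplex s `&` (@coord @^-1` V).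

Lemma realization_openT : realization_open setT.
Proof. by move=> s _ _; exists setT; [exact: openT|rewrite preimage_setT]. Qed.

Lemma realization_openI : setI_closed realization_open.
Proof.
move=> A B oA oB s fs cs.
have [V oV AV] := oA s fs cs; have [W oW BW] := oB s fs cs.
exists (V `&` W); first exact: openI.
move/seteqP: AV => [AV VA]; move/seteqP: BW => [BW WB].
apply/seteqP; split=> t [st] [].
  move=> At Bt; have [_ Vt] := AV t (conj st At).
  by have [_ Wt] := BW t (conj st Bt).
move=> Vt Wt; have [_ At] := VA t (conj st Vt).
by have [_ Bt] := WB t (conj st Wt).
Qed.

Lemma realization_open_bigU (I : Type) (f : I -> set realization) :
  (forall i, realization_open (f i)) -> realization_open (\bigcup_i f i).
Proof.
move=> of_ s fs cs.
have /choice[V hV] : forall i, exists V : set {ptws T -> R}, open V /\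
    closed_simplex s `&` f i = closed_simplex s `&` (@coord @^-1` V).
  by move=> i; have [V oV fV] := of_ i s fs cs; exists V.
exists (\bigcup_i V i); first by apply: bigcup_open => i _; case: (hV i).
apply/seteqP; split=> t [st [i _ it]]; split=> //; exists i => //.
  by have [_ /seteqP[fV _]] := hV i; case: (fV t (conj st it)).
by have [_ /seteqP[_ Vf]] := hV i; case: (Vf t (conj st it)).
Qed.

HB.instance Definition _ := isOpenTopological.Build realization
  realization_openT realization_openI realization_open_bigU.

Definition is_vertex (t : realization) (a : T) :=
  forall x, coord t x = (x == a)%:R.

(* The elements of P lying in the connected component of a. *)
Definition poset_component (a : T) : set T :=
  [set b | exists ta tb : realization, [/\ is_vertex ta a, is_vertex tb b
    & connected_component [set: realization] ta tb]].

End OrderComplex.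

Definition multihom (G H : graph) : set (G -> set H) :=
  [set eta | (forall x, eta x !=set0) /\
    (forall x y, adj x y -> eta x `*` eta y `<=` @edges H)].

Definition multihom_le (G H : graph) (eta eta' : G -> set H) :=
  forall x, eta x `<=` eta' x.

Definition singletons (G H : graph) (u : G -> H) : G -> set H :=
  fun x => [set u x].

Definition multihom_equiv (G H : graph) (f : hom G H) (v : G)
    (tG : graph) (tv : tG) (pG : hom tG G)
    (tH : graph) (tw : tH) (pH : hom tH H) : set (tG -> set tH) :=
  @multihom tG tH `&` [set eta | forall (g : pi12 v) (x : tG),
    eta (act tv pG g x) = act tw pH (pi12_map f g) @` eta x].

Definition prod_adj (G H : graph) : rel (G * H)%type :=
  fun a b => adj a.1 b.1 && adj a.2 b.2.

Lemma prod_adj_sym (G H : graph) : symmetric (@prod_adj G H).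
Proof. by move=> a b; rewrite /prod_adj adj_sym (adj_sym b.2). Qed.

Definition prod_graph (G H : graph) := Graph (@prod_adj_sym G H).

Definition interval_adj n : rel 'I_n.+1 := fun i j => (i <= j.+1) && (j <= i.+1).

Lemma interval_adj_sym n : symmetric (@interval_adj n).
Proof. by move=> i j; rewrite /interval_adj andbC. Qed.

Definition interval_graph n := Graph (@interval_adj_sym n).

Definition times_homotopy (G H : graph) (f : hom G H) n
    (h : hom (prod_graph G (interval_graph n)) H) :=
  forall x : G, h (x, ord0) = f x /\ h (x, ord_max) = f x.

(* The walk (h(v,0), h(v',0), h(v,1), ..., h(v',n-1), h(v,n)), without its
   origin h(v,0). *)
Definition track (G H : graph) n (h : G * 'I_n.+1 -> H) (v v' : G) : seq H :=
  flatten [seq [:: h (v', inord i); h (v, inord i.+1)] | i <- iota 0 n].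

(* The set Pi(f,v) of the classes realized by x-homotopies from f to f. *)
Definition realized (G H : graph) (f : hom G H) (v : G) : set (pi12 (f v)) :=
  [set g | exists n (h : hom (prod_graph G (interval_graph n)) H),
    times_homotopy f h /\
    exists (v' : G) (l : loop (f v)),
      [/\ adj v v', val l = track h v v' & g = \pi_(pi12 (f v)) l]].

(* Main.v *)
From mathcomp Require Import all_boot order ssralg ssrnum interval.
From mathcomp Require Import boolp classical_sets cardinality reals.
From mathcomp Require Import fsbigop topology normedtype.
Require Import Defs.

(* Everything is done upstairs. Walks lift uniquely along a 2-covering, and the
   end of the lift only depends on the 2-homotopy class, so each element of the
   2-fundamental group acts as the unique covering endomorphism with the
   prescribed value at the base point; the action is free and transitive on
   fibres, and [tf] is equivariant. A x-homotopy from [f] to [f] lifts level by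
   level, by bijectivity on second neighbourhoods, to a sequence of equivariant
   homomorphisms starting at [tf]; unique lifting shows that it ends at [g tf],
   where [g] is the class of the track. Conversely any such sequence from [tf]
   to [g tf] descends to a x-homotopy whose track lifts to a walk from [tw] to
   [g tw], so that this track represents [g].
   Consecutive members [u], [u'] of such a sequence lie below the
   multi-homomorphism x |-> {u x, u' x}, so the sequence gives a path in the
   order complex. Conversely, the multi-homomorphisms that contain a homomorphism
   reachable from [tf] by such a sequence are stable under comparability, hence
   span a clopen subset. *)

Set Implicit Arguments.
Unset Strict Implicit.
Unset Printing Implicit Defensive.

Local Open Scope classical_set_scope.
Local Open Scope quotient_scope.

Import Order.TTheory GRing.Theory Num.Theory.
Import numFieldNormedType.Exports.

(** * Unique lifting of walks along a 2-covering *)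

Section WalkLifting.
Variables (tG G : graph) (p : hom tG G).
Hypothesis covp : covering2 p.

(** For a 2-covering the default [a] is returned only if [y] is not adjacent to [p a]. *)
Definition lift_step (a : tG) (y : G) : tG :=
  xget a [set b | adj a b /\ p b = y].

Definition lift_end (a : tG) (s : seq G) : tG := foldl lift_step a s.

Lemma covering2_inj a b c : adj a b -> adj a c -> p b = p c -> b = c.
Proof.
by move=> ab ac; have [[_ inj _] _] := covp a; apply: inj; rewrite inE.
Qed.

Lemma covering2_inj2 a b c d e :
  adj a b -> adj b d -> adj a c -> adj c e -> p d = p e -> d = e.
Proof.
move=> ab bd ac ce; have [_ [_ inj _]] := covp a; apply: inj; rewrite inE.
  by exists b.
by exists c.
Qed.

Lemma lift_stepP a y : adj (p a) y -> adj a (lift_step a y) /\ p (lift_step a y) = y.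
Proof.
move=> ay; have [[_ _ /(_ y ay)[b ab pb]] _] := covp a.
by rewrite /lift_step; case: xgetP => [z _ //|/(_ b)[]].
Qed.

Lemma lift_stepK a b : adj a b -> lift_step a (p b) = b.
Proof.
move=> ab; have [ac pc] := lift_stepP (hom_adj p ab).
exact: covering2_inj ac ab pc.
Qed.

Lemma lift_end_cat a s t : lift_end a (s ++ t) = lift_end (lift_end a s) t.
Proof. exact: foldl_cat. Qed.

Lemma lift_end_proj a s : path adj (p a) s -> p (lift_end a s) = last (p a) s.
Proof.
elim: s a => [//|y s IHs] a /= /andP[ay ys].
by have [_ py] := lift_stepP ay; rewrite IHs py.
Qed.

Lemma lift_end_map a t : path adj a t -> lift_end a (map p t) = last a t.
Proof.
by elim: t a => [//|b t IHt] a /= /andP[ab bt]; rewrite lift_stepK// IHt.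
Qed.

Lemma lift_walk a s : path adj (p a) s ->
  exists t, [/\ path adj a t, map p t = s & last a t = lift_end a s].
Proof.
elim: s a => [|y s IHs] a /=; first by exists [::].
move=> /andP[ay ys]; have [ab pb] := lift_stepP ay.
have [|t [bt pt lt]] := IHs (lift_step a y); first by rewrite pb.
by exists (lift_step a y :: t); rewrite /= ab bt pb pt lt.
Qed.

(** Lifts can be run backwards: a common next vertex forces equal preceding ones, by injectivity on
    its neighbourhood. *)
Lemma lift_end_inj a b s : p a = p b -> path adj (p a) s ->
  lift_end a s = lift_end b s -> a = b.
Proof.
elim: s a b => [//|y s IHs] a b pab /= /andP[ay ys].
have [aa pa] := lift_stepP ay.
have [bb pb] : adj b (lift_step b y) /\ p (lift_step b y) = y.
  by apply: lift_stepP; rewrite -pab.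
move=> /IHs; rewrite pa pb => /(_ erefl ys) e.
by apply: (covering2_inj _ _ pab); rewrite adj_sym; [exact: aa|rewrite e].
Qed.

(** The two lifts separate at the modified position and rejoin one step later, by injectivity on
    second neighbourhoods. Equality of the ends covers a modification at the last position. *)
Lemma lift_end_moveB x0 a s t : size s = size t ->
  (exists i, forall j, j != i -> nth x0 s j = nth x0 t j) ->
  path adj (p a) s -> path adj (p a) t -> last (p a) s = last (p a) t ->
  lift_end a s = lift_end a t.
Proof.
elim: s t a => [|x s IHs] [|y t]//= a [st] [i hi] /andP[ax xs] /andP[ay yt] lst.
have [ab pb] := lift_stepP ax; have [ac pc] := lift_stepP ay.
case: i hi => [|i] hi.
  have est : s = t by apply: (@eq_from_nth _ x0) => // j _; exact: (hi j.+1).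
  move: est xs yt lst => -> {hi st IHs s}; case: t => [_ _ /= -> //|z s] /=.
  move=> /andP[xz _] /andP[yz _] _; congr foldl.
  have [|bz pz] := @lift_stepP (lift_step a x) z; first by rewrite pb.
  have [|cz pz'] := @lift_stepP (lift_step a y) z; first by rewrite pc.
  by apply: covering2_inj2 ab bz ac cz _; rewrite pz.
have exy : x = y by exact: (hi 0).
subst y; apply: IHs; rewrite ?pb//.
by exists i => j ji; exact: (hi j.+1).
Qed.

Lemma lift_end_homotopic a (k l : loop (p a)) :
  homotopic k l -> lift_end a (val k) = lift_end a (val l).
Proof.
move=> /asboolP; elim=> {k l} [k l|//|//|k l m _ -> //].
have /andP[pk /eqP lk] := valP k; have /andP[pl /eqP ll] := valP l.
case=> [[p1 [p2 [y [ek ay el]]]]|[skl hi]]; last first.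
  by apply: (@lift_end_moveB (p a)) => //; rewrite lk ll.
rewrite ek el !lift_end_cat.
move: pk; rewrite ek cat_path => /andP[/lift_end_proj p1E _].
rewrite -p1E in ay *.
have [ab pb] := lift_stepP ay.
by rewrite [RHS]/lift_end /= lift_stepK// adj_sym.
Qed.

End WalkLifting.

(** The image of a walk under [F] is itself the lift of its projection. *)
Lemma lift_end_hom (tG tH H : graph) (q : hom tH H) (F : tG -> tH) a t :
  covering2 q -> {homo F : x y / adj x y} -> path adj a t ->
  lift_end q (F a) (map (q \o F) t) = F (last a t).
Proof.
move=> covq Fh at_; rewrite map_comp lift_end_map ?last_map// path_map.
by apply: sub_path at_ => x y /Fh.
Qed.

Lemma lift_unique (tG tH H : graph) (q : hom tH H) (F F' : tG -> tH) a :
  covering2 q -> connected_graph tG ->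
  {homo F : x y / adj x y} -> {homo F' : x y / adj x y} ->
  q \o F =1 q \o F' -> F a = F' a -> F =1 F'.
Proof.
move=> covq conn Fh Fh' qF Fa x; have [t at_ <-] := conn a x.
rewrite -(lift_end_hom covq Fh at_) -(lift_end_hom covq Fh' at_).
by rewrite Fa (eq_map qF).
Qed.

(** * The action of the 2-fundamental group on the universal 2-covering *)

Lemma pi12_mulgE (G : graph) (v : G) (k l : loop v) :
  (\pi_(pi12 v) k * \pi_(pi12 v) l)%g = \pi_(pi12 v) (loopM k l).
Proof. exact: pi12_mulE. Qed.

Lemma pi12_mapM (G H : graph) (f : hom G H) (v : G) (g g' : pi12 v) :
  pi12_map f (g * g')%g = (pi12_map f g * pi12_map f g')%g.
Proof.
rewrite -[g]reprK -[g']reprK pi12_mulgE !pi12_mapE pi12_mulgE.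
by apply/pi12_eqP/homotopic_val; rewrite /= map_cat.
Qed.

Section DeckAction.
Variables (tG G : graph) (tv : tG) (v : G) (p : hom tG G).
Hypothesis univ : universal_covering2 tv v p.

Let pv : p tv = v. Proof. by case: univ. Qed.
Let covp : covering2 p. Proof. by case: univ. Qed.
Let conn : connected_graph tG. Proof. by case: univ. Qed.

Lemma closed_walk_proj t : path adj tv t -> p (last tv t) = v ->
  closed_walk v (map p t).
Proof.
move=> tp lt; rewrite /closed_walk -{1 2}pv last_map lt eqxx andbT path_map.
by apply: sub_path tp => x y; exact: hom_adj.
Qed.

Lemma lift_end_loop a (k l : loop v) : p a = v ->
  \pi_(pi12 v) k = \pi_(pi12 v) l -> lift_end p a (val k) = lift_end p a (val l).
Proof.
by move=> pa; move: k l; rewrite -pa => k l /pi12_eqP; apply: lift_end_homotopic.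
Qed.

(* A closed walk upstairs is null-homotopic, hence so is its projection. *)
Lemma projected_loop_trivial t (l : loop v) : path adj tv t -> last tv t = tv ->
  val l = map p t -> \pi_(pi12 v) l = 1%g.
Proof.
have trivial : forall g : pi12 tv, g = 1%g by case: univ.
move=> tp lt; have ct : closed_walk tv t by rewrite /closed_walk tp lt eqxx.
move: l; rewrite -pv => l lE.
have := trivial (\pi_(pi12 tv) (Sub t ct)) => /(congr1 (@pi12_map _ _ p tv)).
rewrite [X in _ = X -> _](pi12_mapE p (loop1 tv)) pi12_mapE => tE.
transitivity (\pi_(pi12 (p tv)) (loop_map p (Sub t ct))).
  exact/pi12_eqP/homotopic_val.
by rewrite tE; exact/pi12_eqP/homotopic_val.
Qed.

(** One walk [u] from the common end back to [tv] closes both lifts, so both classes are inverse to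
    the same class. *)
Lemma lift_end_loop_inj (k l : loop v) :
  lift_end p tv (val k) = lift_end p tv (val l) ->
  \pi_(pi12 v) k = \pi_(pi12 v) l.
Proof.
have /andP[pk /eqP lk] := valP k; have /andP[pl /eqP ll] := valP l.
have [|s [sp ks ls]] := @lift_walk _ _ _ covp tv (val k); first by rewrite pv.
have [|t [tp lt lst]] := @lift_walk _ _ _ covp tv (val l); first by rewrite pv.
rewrite -ls -lst => est; have [u up lu] := conn (last tv s) tv.
have sup : path adj tv (s ++ u) by rewrite cat_path sp up.
have tup : path adj tv (t ++ u) by rewrite cat_path tp -est up.
have pls : p (last tv s) = v by rewrite ls lift_end_proj// pv.
have cu : closed_walk v (map p u).
  rewrite /closed_walk -{1 2}pls last_map lu pv eqxx andbT path_map.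
  by apply: sub_path up => x y; exact: hom_adj.
pose m : loop v := Sub (map p u) cu.
have km : (\pi_(pi12 v) k * \pi_(pi12 v) m)%g = 1%g.
  rewrite pi12_mulgE; apply: projected_loop_trivial sup _ _.
    by rewrite last_cat.
  by rewrite /= map_cat ks.
have lm : (\pi_(pi12 v) l * \pi_(pi12 v) m)%g = 1%g.
  rewrite pi12_mulgE; apply: projected_loop_trivial tup _ _.
    by rewrite last_cat -est.
  by rewrite /= map_cat lt.
by apply: (@mulIg _ (\pi_(pi12 v) m)); rewrite km lm.
Qed.

(** Closed up by a common [u], both walks project to the trivial class, so their lifts from any [b]
    in the fibre end together; [u] is then removed by lifting backwards. *)
Lemma lift_end_path b s t : p b = v -> path adj tv s -> path adj tv t ->
  last tv s = last tv t -> lift_end p b (map p s) = lift_end p b (map p t).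
Proof.
move=> pb sp tp est; have [u up lu] := conn (last tv s) tv.
have sup : path adj tv (s ++ u) by rewrite cat_path sp up.
have tup : path adj tv (t ++ u) by rewrite cat_path tp -est up.
have csu : closed_walk v (map p (s ++ u)).
  by apply: closed_walk_proj => //; rewrite last_cat lu.
have ctu : closed_walk v (map p (t ++ u)).
  by apply: closed_walk_proj => //; rewrite last_cat -est lu.
have : lift_end p b (map p (s ++ u)) = lift_end p b (map p (t ++ u)).
  apply: (@lift_end_loop b (Sub _ csu) (Sub _ ctu)) => //.
  rewrite (@projected_loop_trivial (s ++ u))// ?last_cat//.
  by rewrite (@projected_loop_trivial (t ++ u))// ?last_cat -?est.
have pp r : path adj tv r -> path adj (p b) (map p r).
  rewrite pb -pv path_map; apply: sub_path => x y; exact: hom_adj.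
rewrite !map_cat !lift_end_cat; apply: lift_end_inj => //.
  by rewrite !lift_end_proj ?pp// pb -pv !last_map est.
move: (pp _ sup); rewrite map_cat cat_path => /andP[_].
by rewrite lift_end_proj ?pp.
Qed.

(** The choices of representative and of walk in [is_act] are immaterial, so the action is computed
    from any of them. *)
Lemma actE (k : loop v) x t : path adj tv t -> last tv t = x ->
  act tv p (\pi_(pi12 v) k) x = lift_end p (lift_end p tv (val k)) (map p t).
Proof.
move=> tp lt; have /andP[pk /eqP lk] := valP k.
have pb : p (lift_end p tv (val k)) = v by rewrite lift_end_proj// pv.
have act_uniq z : is_act tv p (\pi_(pi12 v) k) x z ->
    z = lift_end p (lift_end p tv (val k)) (map p t).
  case=> l [phi [psi [kl [phip lphi] [psip psiE] <-]]].
  rewrite -(lift_end_map covp psip) psiE lift_end_cat (lift_end_loop pv kl).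
  by apply: lift_end_path; rewrite ?lphi// -(lift_end_loop pv kl).
rewrite /act; case: xgetP => [z _ /act_uniq //|no_act].
have [|psi [psip psiE _]] := @lift_walk _ _ _ covp tv (val k ++ map p t).
  rewrite pv cat_path pk lk -pv path_map.
  by apply: sub_path tp => ? ?; exact: hom_adj.
by case: (no_act (last tv psi)); exists k, t, psi.
Qed.

Lemma act_base (k : loop v) : act tv p (\pi_(pi12 v) k) tv = lift_end p tv (val k).
Proof. exact: (@actE k tv [::]). Qed.

Lemma act_proj (g : pi12 v) x : p (act tv p g x) = p x.
Proof.
rewrite -[g]reprK; have [t tp lt] := conn tv x.
have /andP[pk /eqP lk] := valP (repr g).
have pb : p (lift_end p tv (val (repr g))) = v by rewrite lift_end_proj// pv.
rewrite (actE _ tp lt) lift_end_proj// pb -pv ?last_map ?lt// path_map.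
by apply: sub_path tp => ? ?; exact: hom_adj.
Qed.

Lemma act_adj (g : pi12 v) : {homo act tv p g : x y / adj x y}.
Proof.
move=> x y xy; have [t tp lt] := conn tv x.
(* Computed along [t] followed by the edge to [y], the image of [y] is one lifting step after that
   of [x]. *)
have gE : act tv p g y = lift_step p (act tv p g x) (p y).
  rewrite -[g]reprK (@actE _ y (rcons t y)) ?last_rcons//.
    by rewrite (actE _ tp lt) map_rcons -cats1 lift_end_cat.
  by rewrite rcons_path tp lt.
rewrite gE; apply: (lift_stepP covp _).1.
by rewrite act_proj; exact: hom_adj.
Qed.

(** Freeness: by unique lifting, agreement at one point spreads to [tv], whose image determines the
    class. *)
Lemma act_eq (g g' : pi12 v) x : act tv p g x = act tv p g' x -> g = g'.
Proof.
move=> gg'; have : act tv p g =1 act tv p g'.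
  apply: (@lift_unique _ _ _ p _ _ x) => //; try exact: act_adj.
  by move=> y /=; rewrite !act_proj.
rewrite -[g]reprK -[g']reprK => /(_ tv); rewrite !act_base.
exact: lift_end_loop_inj.
Qed.

Lemma act_mul (g g' : pi12 v) x : act tv p (g * g')%g x = act tv p g (act tv p g' x).
Proof.
move: x; apply: (@lift_unique _ _ _ p _ _ tv) => //=; try exact: act_adj.
- by move=> x y xy; do 2 apply: act_adj.
- by move=> y /=; rewrite !act_proj.
rewrite -[g]reprK -[g']reprK pi12_mulgE !act_base /= lift_end_cat.
have /andP[pk _] := valP (repr g').
have [|t [tp tE lt]] := @lift_walk _ _ _ covp tv (val (repr g')).
  by rewrite pv.
by rewrite (actE _ tp lt) tE.
Qed.

Lemma act_trans x y : p x = p y -> exists g : pi12 v, act tv p g x = y.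
Proof.
move=> pxy; have [u up lu] := conn x tv.
have pu : path adj (p x) (map p u).
  by rewrite path_map; apply: sub_path up => ? ?; exact: hom_adj.
(* If some [g] carries [x] to [y], it carries [tv] to [b]. The class of a projected walk from [tv]
   to [b] does so, and lifting [u] backwards from [b] gives [y]. *)
pose b := lift_end p y (map p u).
have pb : p b = v by rewrite lift_end_proj -?pxy// last_map lu.
have [t tp lt] := conn tv b.
have ct : closed_walk v (map p t) by apply: closed_walk_proj; rewrite ?lt.
pose g := \pi_(pi12 v) (Sub _ ct : loop v); exists g.
have gb : act tv p g tv = b by rewrite act_base/= lift_end_map.
apply: (lift_end_inj covp _ _ (s := map p u)); rewrite ?act_proj//.
rewrite -/b -gb; have := lift_end_hom covp (@act_adj g) up; rewrite lu => <-.
by congr lift_end; apply: eq_map => z /=; rewrite act_proj.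
Qed.

End DeckAction.

(** * Connected components of an order complex *)

Section OrderComplexComponents.
Variables (R : realType) (T : choiceType) (le : T -> T -> Prop) (P : set T).
Hypothesis le_refl : forall x, le x x.

Local Notation realization := (@realization R T le P).
Local Open Scope ring_scope.

(* The support of a point is a chain, so it cannot meet both [C] and its
   complement: the points supported in [C] form a clopen set. *)
Lemma poset_component_closed (C : set T) a b :
  (forall x y, P x -> P y -> le x y -> C x <-> C y) ->
  poset_component R le P a b -> C a -> C b.
Proof.
move=> Cle [ta [tb [va vb [A [Ata _ connA] Atb]]]] Ca.
pose K : set realization := [set t | forall x, coord t x != 0 -> C x].
pose K' : set realization := [set t | forall x, coord t x != 0 -> ~ C x].
have chainC s x y : is_chain le P s -> s x -> s y -> C x -> C y.
  move=> [sP sle] sx sy Cx.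
  by case: (sle x y sx sy) => /Cle h; apply/h => //; exact: sP.
have support_neq0 (t : realization) : exists x, coord t x != 0.
  apply: contrapT => /forallNP t0; have := coord_sum t.
  rewrite (eq_fsbigr (fun=> 0)) ?fsbig1//; last first.
    by move=> x _; apply/eqP/negP => tx; apply: (t0 x); apply/negP.
  by move=> /eqP; rewrite eq_sym oner_eq0.
have K'E : K' = ~` K.
  apply/seteqP; split=> t.
    by move=> K't Kt; have [x tx] := support_neq0 t; exact: K't (Kt x tx).
  move=> /existsNP[x /not_implyP[tx nCx]] y ty Cy.
  exact: nCx (chainC _ _ _ (coord_chain t) ty tx Cy).
have openK : open K.
  (* A chain lies entirely inside or outside [C], so the trace of [K] on its simplex is everything
     or empty. *)
  move=> s _ chs; have [[x [sx Cx]]|nsC] := pselect (exists x, s x /\ C x).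
    exists setT; first exact: openT.
    apply/seteqP; split=> t [st _]; split=> //= y ty.
    exact: chainC chs sx (st y ty) Cx.
  exists set0; first exact: open0.
  apply/seteqP; split=> t [st] //= Kt; have [x tx] := support_neq0 t.
  by exfalso; apply: nsC; exists x; split; [exact: st|exact: Kt].
have openK' : open K'.
  move=> s _ chs; have [[x [sx Cx]]|nsC] := pselect (exists x, s x /\ ~ C x).
    exists setT; first exact: openT.
    apply/seteqP; split=> t [st _]; split=> //= y ty Cy.
    exact: Cx (chainC _ _ _ chs (st y ty) sx Cy).
  exists set0; first exact: open0.
  apply/seteqP; split=> t [st] //= Kt; have [x tx] := support_neq0 t.
  by exfalso; apply: nsC; exists x; split; [exact: st|exact: Kt].
have Kta : K ta by move=> x; rewrite va; case: (x =P a) => [->//|_]; rewrite eqxx.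
have AK : A `&` K = A.
  apply: connA; first by exists ta.
    by exists K.
  by exists K => //; rewrite -[K]setCK -K'E; exact: open_closedC.
have [_ Ktb] : (A `&` K) tb by rewrite AK.
by apply: Ktb; rewrite vb eqxx oner_eq0.
Qed.

Lemma prod_topology_continuous (S : topologicalType) (I : choiceType)
    (V : topologicalType) (F : S -> {ptws I -> V}) :
  (forall i, continuous (fun s => F s i)) -> continuous F.
Proof.
move=> Fi s; apply/cvg_sup => i.
exact: (@continuous_comp_initial {ptws I -> V} S V (fun g => g i) F (Fi i)).
Qed.

Section Segment.
Variables (a b : T).
Hypotheses (Pa : P a) (Pb : P b) (leab : le a b).

(** Truncation to the unit interval makes the segment from [a] to [b] a map on all of [R]. *)
Definition clamp (t : R) : R := Num.min 1 (Num.max 0 t).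

Definition segment_coord (t : R) (x : T) : R :=
  (1 - clamp t) * (x == a)%:R + clamp t * (x == b)%:R.

Lemma clamp_ge0 t : 0 <= clamp t.
Proof. by rewrite le_min ler01 le_max lexx. Qed.

Lemma clamp_le1 t : clamp t <= 1.
Proof. by rewrite ge_min lexx. Qed.

Lemma segment_coord_ge0 t x : 0 <= segment_coord t x.
Proof.
by rewrite addr_ge0// mulr_ge0// ?ler0n ?subr_ge0 ?clamp_le1 ?clamp_ge0.
Qed.

Lemma segment_coord_support t :
  [set x | segment_coord t x != 0] `<=` [set a; b].
Proof.
move=> x /=; rewrite /segment_coord.
case: (x =P a) => [|_]; first by left.
by case: (x =P b) => [|_]; [right|rewrite !mulr0 addr0 eqxx].
Qed.

Lemma segment_chain (s : set T) : s `<=` [set a; b] -> is_chain le P s.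
Proof.
move=> sab; split=> [x /sab[]->//|x y /sab xab /sab yab].
by case: xab yab => -> [] ->; auto.
Qed.

Lemma segment_coord_sum t : \sum_(x \in [set: T]) segment_coord t x = 1.
Proof.
have fin_ab : finite_set [set a; b] by rewrite finite_setU; split.
rewrite -(@fsbig_widen _ _ _ _ [set a; b])//; last first.
  move=> x [_ nx]; apply/eqP/negPn/negP => tx.
  exact: nx (segment_coord_support tx).
have dirac_sum c : c \in [set a; b] ->
      \sum_(x \in [set a; b]) ((x == c)%:R : R) = 1.
  rewrite inE => cab; rewrite -(@fsbig_widen _ _ _ _ [set c]) ?fsbig_set1 ?eqxx//.
    by move=> x ->.
  by move=> x [_ /eqP/negPf xc]; rewrite /= xc.
rewrite /segment_coord fsbig_split//= -!mulr_fsumr// !dirac_sum ?mulr1 ?subrK//.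
  by rewrite inE; right.
by rewrite inE; left.
Qed.

Definition segment_point (t : R) : realization :=
  Realization (segment_coord_ge0 t)
    (sub_finite_set (@segment_coord_support t) (finite_set2 a b))
    (segment_chain (@segment_coord_support t)) (segment_coord_sum t).

Lemma clamp_continuous : continuous clamp.
Proof.
move=> t; apply: continuous_min; first exact: cst_continuous.
by apply: continuous_max; [exact: cst_continuous|exact: cvg_id].
Qed.

Lemma segment_coord_continuous : continuous (segment_coord : R -> {ptws T -> R}).
Proof.
apply: prod_topology_continuous => x t; rewrite /segment_coord.
apply: cvgD; apply: cvgMl; last exact: clamp_continuous.
by apply: cvgB; [exact: cvg_cst|exact: clamp_continuous].
Qed.

(** The segment stays in the closed simplex on [a] and [b], where openness is tested on
    coordinates. *)
Lemma segment_point_continuous : continuous segment_point.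
Proof.
apply/continuousP => U oU.
have [V oV UV] := oU [set a; b] (finite_set2 a b) (segment_chain (@subset_refl _ _)).
suff -> : segment_point @^-1` U = segment_coord @^-1` V.
  by move/continuousP: segment_coord_continuous; apply.
have sab t : closed_simplex [set a; b] (segment_point t).
  exact: segment_coord_support.
apply/seteqP; split=> t /= Ut.
  have : (closed_simplex [set a; b] `&` U) (segment_point t) by [].
  by rewrite UV => -[].
have : (closed_simplex [set a; b] `&` (@coord R T le P @^-1` V)) (segment_point t) by [].
by rewrite -UV => -[].
Qed.

End Segment.

Lemma vertex_unique (t t' : realization) a :
  is_vertex t a -> is_vertex t' a -> t = t'.
Proof.
case: t t' => [c c0 cf cc cs] [d d0 df dc ds] /= cv dv.
have cd : c = d by apply/funext => x; move: (cv x) (dv x) => /= -> ->.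
subst d; by congr Realization; exact: Prop_irrelevance.
Qed.

Lemma poset_component_le a b : P a -> P b -> le a b -> poset_component R le P a b.
Proof.
move=> Pa Pb leab; pose sp := segment_point Pa Pb leab.
exists (sp 0), (sp 1); split.
- move=> x; rewrite /= /segment_coord /clamp maxxx min_r ?ler01//.
  by rewrite subr0 mul1r mul0r addr0.
- move=> x; rewrite /= /segment_coord /clamp max_r ?ler01// minxx.
  by rewrite subrr mul1r mul0r add0r.
exists (sp @` `[0, 1]); last by exists 1; rewrite //= in_itv/= ler01 lexx.
split=> //; first by exists 0; rewrite //= in_itv/= ler01 lexx.
apply: connected_continuous_connected; first exact: segment_connected.
exact/continuous_subspaceT/segment_point_continuous.
Qed.

Lemma poset_component_sym a b :
  poset_component R le P a b -> poset_component R le P b a.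
Proof.
by case=> ta [tb [va vb /connected_component_sym tba]]; exists tb, ta.
Qed.

Lemma poset_component_trans a b c : poset_component R le P a b ->
  poset_component R le P b c -> poset_component R le P a c.
Proof.
move=> [ta [tb [va vb tab]]] [tb' [tc [vb' vc tbc]]]; exists ta, tc; split=> //.
by apply: connected_component_trans tab _; rewrite (vertex_unique vb vb').
Qed.

End OrderComplexComponents.

(** * Equivariant homomorphisms and chains of them *)

Lemma exists_neighbour (G : graph) : connected_graph G -> @edges G !=set0 ->
  forall x : G, exists y, adj x y.
Proof.
move=> conn [[a b] /= ab] x; have [[|y p] /= xp lp] := conn x a.
  by exists b; rewrite lp.
by exists y; case/andP: xp.
Qed.

Lemma covering2_surj (tG G : graph) (tv : tG) (p : hom tG G) :
  covering2 p -> connected_graph G -> forall x : G, exists a, p a = x.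
Proof.
move=> covp conn x; have [s ps <-] := conn (p tv) x.
by exists (lift_end p tv s); rewrite lift_end_proj.
Qed.

Section EquivariantHomotopy.
Variables (G H : graph) (f : hom G H) (v : G).
Variables (tG : graph) (tv : tG) (pG : hom tG G).
Variables (tH : graph) (tw : tH) (pH : hom tH H).
Hypotheses (univG : universal_covering2 tv v pG)
  (univH : universal_covering2 tw (f v) pH)
  (connG : connected_graph G) (edgeG : @edges G !=set0).

Let pGv : pG tv = v. Proof. by case: univG. Qed.
Let covG : covering2 pG. Proof. by case: univG. Qed.
Let conntG : connected_graph tG. Proof. by case: univG. Qed.
Let pHw : pH tw = f v. Proof. by case: univH. Qed.
Let covH : covering2 pH. Proof. by case: univH. Qed.

(* For homomorphisms [u] and [u'], this says that they are the two ends of a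
   homomorphism on the product of [X] with the interval of length 1. *)
Definition adjacent_maps (X Y : graph) (u u' : X -> Y) :=
  forall x y, adj x y -> adj (u x) (u' y).

Definition equivariant_hom (u : tG -> tH) := adjacent_maps u u /\
  forall (g : pi12 v) x, u (act tv pG g x) = act tw pH (pi12_map f g) (u x).

(** [Q] depends on the index so that a chain can also record which level of a homotopy each member
    lifts. *)
Definition homotopy_chain (Q : nat -> (tG -> tH) -> Prop) u n :=
  (forall i, i <= n -> Q i (u i)) /\
  (forall i, i < n -> adjacent_maps (u i) (u i.+1)).

Lemma homotopy_chain_rcons Q u n u' : homotopy_chain Q u n ->
  adjacent_maps (u n) u' -> Q n.+1 u' ->
  exists w, [/\ homotopy_chain Q w n.+1, w 0 = u 0 & w n.+1 = u'].
Proof.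
move=> [Qu uu] unu' Qu'; exists (fun i => if i <= n then u i else u').
split=> //; last by rewrite ltnn.
split=> i.
  by rewrite leq_eqVlt ltnS => /predU1P[->|lein]; rewrite ?ltnn ?lein//; exact: Qu.
rewrite ltnS => lein; rewrite lein; move: lein.
rewrite leq_eqVlt => /predU1P[->|ltin]; first by rewrite ltnn.
by rewrite ltin; exact: uu.
Qed.

Lemma adjacent_maps_sym (X Y : graph) (u u' : X -> Y) :
  adjacent_maps u u' -> adjacent_maps u' u.
Proof. by move=> uu' x y xy; rewrite adj_sym; apply: uu'; rewrite adj_sym. Qed.

(** This is what makes [pH \o u] descend to [G]. *)
Lemma equivariant_hom_proj u x y : equivariant_hom u -> pG x = pG y ->
  pH (u x) = pH (u y).
Proof.
by move=> [_ ueq] /(act_trans univG)[g <-]; rewrite ueq (act_proj univH).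
Qed.

(** Both sides of the equivariance identity have projection [f \o pG], and at [tv] both are the end
    of the lift from [tw] of the image under [f] of a loop representing [g]. *)
Lemma equivariant_hom_lift (u : tG -> tH) : u tv = tw -> adjacent_maps u u ->
  (forall x, pH (u x) = f (pG x)) -> equivariant_hom u.
Proof.
move=> utv uadj upr; split=> // g.
apply: (@lift_unique _ _ _ pH _ _ tv) => //.
- by move=> x y xy; apply/uadj/(act_adj univG).
- by move=> x y xy; apply/(act_adj univH)/uadj.
- by move=> x /=; rewrite upr (act_proj univG) (act_proj univH) upr.
rewrite -[g]reprK pi12_mapE utv (act_base univG) (act_base univH) /=.
have /andP[pk _] := valP (repr g).
have [|t [tp tE <-]] := @lift_walk _ _ _ covG tv (val (repr g)).
  by rewrite pGv.
rewrite -(lift_end_hom covH uadj tp) utv -tE -map_comp.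
by congr lift_end; apply: eq_map => x /=; rewrite upr.
Qed.

Lemma multihom_equiv_pair u u' : equivariant_hom u -> equivariant_hom u' ->
  adjacent_maps u u' ->
  multihom_equiv f v tv pG tw pH (fun x => [set u x; u' x]).
Proof.
move=> [uu ueq] [uu' ueq'] adj_uu'; split.
  split=> [x|x y xy [a b] [/= ax bx]]; first by exists (u x); left.
  case: ax bx => -> [] ->; rewrite /edges/=.
  - exact: uu.
  - exact: adj_uu'.
  - exact: adjacent_maps_sym adj_uu' _ _ xy.
  - exact: uu'.
move=> g x /=; apply/seteqP; split=> [a [->|->]|_ [a [->|->]] <-].
- by exists (u x); [left|rewrite ueq].
- by exists (u' x); [right|rewrite ueq'].
- by left; rewrite ueq.
- by right; rewrite ueq'.
Qed.

Lemma singletonsE (X Y : graph) (u : X -> Y) :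
  singletons u = fun x => [set u x; u x].
Proof. by apply/funext => x; rewrite /singletons setUid. Qed.

Lemma multihom_equiv_singletons u : equivariant_hom u ->
  multihom_equiv f v tv pG tw pH (singletons u).
Proof.
by move=> uE; rewrite singletonsE; apply: multihom_equiv_pair => //; case: uE.
Qed.

(* The action on [tG] is free and transitive on fibres, so values chosen at one
   representative of each fibre extend equivariantly. *)
Lemma equivariant_selection eta : multihom_equiv f v tv pG tw pH eta ->
  exists2 u, equivariant_hom u & forall x, eta x (u x).
Proof.
move=> [[eta0 etaadj] etaeq].
have [s sK] := choice (covering2_surj tv covG connG).
have [c cP] := choice (fun x => eta0 (s x)).
have /choice[d dP] : forall a, exists g : pi12 v, act tv pG g (s (pG a)) = a.
  by move=> a; apply: (act_trans univG); rewrite sK.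
pose u a := act tw pH (pi12_map f (d a)) (c (pG a)).
have etau x : eta x (u x) by rewrite -{1}(dP x) etaeq; exists (c (pG x)).
exists u => //; split=> [x y xy|g x].
  exact: (etaadj x y xy (u x, u y)).
(* Both elements carry [s (pG x)] to [act tv pG g x]; freeness identifies them. *)
have dg : d (act tv pG g x) = (g * d x)%g.
  apply: (act_eq univG (x := s (pG x))).
  by rewrite (act_mul univG) dP -(act_proj univG g) dP.
by rewrite /u (act_proj univG) dg pi12_mapM (act_mul univH).
Qed.

(* [u' x] is the unique point of [N^2(u x)] above [k' (pG x)]. *)
Lemma homotopy_lift_step (k k' : G -> H) u : adjacent_maps k k' ->
  adjacent_maps k' k' -> equivariant_hom u -> (forall x, pH (u x) = k (pG x)) ->
  exists u', [/\ adjacent_maps u u', equivariant_hom u'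
    & forall x, pH (u' x) = k' (pG x)].
Proof.
move=> kk' k'k' [uu ueq] uk.
have nbr (x : tG) : exists y, adj x y.
  have [y xy] := exists_neighbour connG edgeG (pG x).
  by exists (lift_step pG x y); case: (lift_stepP covG xy).
have /choice[u' u'P] : forall x, exists z,
    (exists2 y, adj (u x) y & adj y z) /\ pH z = k' (pG x).
  move=> x; have [y xy] := nbr x.
  have [|yz pz] := lift_stepP covH (_ : adj (pH (u y)) (k' (pG x))).
    by rewrite uk; apply: kk'; rewrite adj_sym; exact: hom_adj.
  by eexists; split; [exists (u y); [exact: uu|exact: yz]|exact: pz].
(* The intermediate vertex [y] is arbitrary: routing through [u x], [u' y] and a translated vertex
   in turn yields the three required properties. *)
have u'_uniq x y z : adj (u x) y -> adj y z -> pH z = k' (pG x) -> z = u' x.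
  move=> xy yz pz; have [[y' xy' y'z] pz'] := u'P x.
  by apply: (covering2_inj2 covH xy yz xy' y'z); rewrite pz.
have uu' : adjacent_maps u u'.
  move=> x y xy; have [|yz pz] := lift_stepP covH (_ : adj (pH (u x)) (k' (pG y))).
    by rewrite uk; apply: kk'; exact: hom_adj.
  rewrite -(u'_uniq y (u x) _ _ yz pz)//.
  by apply: uu; rewrite adj_sym.
exists u'; split=> //; last by move=> x; case: (u'P x).
split=> [x y xy|g x].
  have [_ py] := u'P y.
  have [|yz pz] := lift_stepP covH (_ : adj (pH (u' y)) (k' (pG x))).
    by rewrite py; apply: k'k'; rewrite adj_sym; exact: hom_adj.
  by rewrite -(u'_uniq x (u' y) _ (uu' _ _ xy) yz pz) adj_sym.
have [[y xy yz] pz] := u'P x; symmetry.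
apply: (u'_uniq _ (act tw pH (pi12_map f g) y)).
- by rewrite ueq; exact: (act_adj univH).
- exact: (act_adj univH).
- by rewrite (act_proj univH) (act_proj univG).
Qed.

(** * Tracks, and the passage between x-homotopies and chains *)

(** The walk alternates a step from [a] to [a'] within level [i] and a step back to [a] into level
    [i.+1]. *)
Lemma track_path Q u n a a' : (forall i u', Q i u' -> adjacent_maps u' u') ->
  homotopy_chain Q u n -> adj a a' ->
  let t := flatten [seq [:: u i a'; u i.+1 a] | i <- iota 0 n] in
  path adj (u 0 a) t /\ last (u 0 a) t = u n a.
Proof.
move=> Qadj + aa'; elim: n => [//|n IHn] [Qu uu] t; rewrite {}/t.
have [|pt lt] := IHn.
  by split=> i lein; [apply: Qu; exact: leqW|apply: uu; exact: leqW].
have -> : iota 0 n.+1 = iota 0 n ++ [:: n] by rewrite -addn1 iotaD.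
rewrite map_cat flatten_cat cat_path last_cat lt /=.
rewrite pt (Qadj n (u n) (Qu n (leqnSn n)) _ _ aa') /=.
by rewrite (uu n (ltnSn n) a' a)// adj_sym.
Qed.

Lemma track_proj n (h : G * 'I_n.+1 -> H) (u : nat -> tG -> tH) a a' :
  (forall i x, i <= n -> pH (u i x) = h (pG x, inord i)) ->
  track h (pG a) (pG a') =
    map pH (flatten [seq [:: u i a'; u i.+1 a] | i <- iota 0 n]).
Proof.
move=> uh; rewrite map_flatten -map_comp /track; congr flatten.
apply/eq_in_map => i; rewrite mem_iota add0n /= => ltin.
by rewrite !uh// ltnW.
Qed.

Variables (tf : hom tG tH) (varpi : pi12 (f v)).
Hypotheses (tf_based : tf tv = tw) (tf_lift : forall x, pH (tf x) = f (pG x)).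

Let tf_equivariant : equivariant_hom tf.
Proof. by apply: equivariant_hom_lift => // x y; exact: hom_adj. Qed.

Let act_tf (x : tG) := act tw pH varpi (tf x).

Lemma realized_chain : realized varpi ->
  exists u n, [/\ homotopy_chain (fun=> equivariant_hom) u n,
    u 0 = tf & u n = act_tf].
Proof.
case=> n [h [h0n [v' [l [vv' lE piE]]]]].
pose k i x := h (x, inord i).
have kk i : adjacent_maps (k i) (k i).
  by move=> x y xy; apply: hom_adj; rewrite /= /prod_adj xy/= /interval_adj/= leqnSn.
have kk' i : i < n -> adjacent_maps (k i) (k i.+1).
  move=> ltin x y xy; apply: hom_adj; rewrite /= /prod_adj xy/= /interval_adj/=.
  by rewrite (inordK (leqW ltin)) inordK// leqnn (leqW (leqnSn i)).
pose Q i u := equivariant_hom u /\ forall x, pH (u x) = k i (pG x).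
have inord0 : inord 0 = ord0 :> 'I_n.+1 by apply/val_inj; rewrite /= inordK.
have inordn : inord n = ord_max :> 'I_n.+1 by apply/val_inj; rewrite /= inordK.
have [u [[Qu uu] u0]] : exists u, homotopy_chain Q u n /\ u 0 = tf.
  have : n <= n by [].
  (* The induction is on the height [m] reached, with [n] fixed, since [k] describes the homotopy
     only up to level [n]. *)
  elim: {-2}n => [_|m IHm ltmn].
    exists (fun=> tf : tG -> tH); split=> //; split=> // i.
    rewrite leqn0 => /eqP ->; split=> // x.
    by rewrite tf_lift /k inord0; case: (h0n (pG x)).
  have [|u [cu u0]] := IHm; first exact: ltnW.
  have [eum umk] := cu.1 m (leqnn m).
  have [u' [uu' eu' u'k]] := homotopy_lift_step (kk' m ltmn) (kk m.+1) eum umk.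
  have [w [cw w0 _]] := @homotopy_chain_rcons Q u m u' cu uu' (conj eu' u'k).
  by exists w; rewrite w0.
exists u, n; split=> //; first by split=> // i /Qu[].
have vv0 : adj (pG tv) v' by rewrite pGv.
have [tvv' pv'] := lift_stepP covG vv0; set tv' := lift_step _ _ _ in tvv' pv'.
(* Both maps lift [f \o pG]. At [tv], the lift of the track from [tw] ends at [u n tv], and its
   class is [varpi]. *)
apply/funext; apply: (@lift_unique _ _ _ pH _ _ tv) => //.
- by case: (Qu n) => // -[].
- by move=> x y xy; apply: (act_adj univH); exact: hom_adj.
- move=> x /=; case: (Qu n) => // _ ->; rewrite (act_proj univH) tf_lift.
  by rewrite /k inordn; case: (h0n (pG x)).
rewrite /act_tf tf_based piE (act_base univH) lE.
have [|pt lt] := @track_path Q u n tv tv' _ (conj Qu uu) tvv'.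
  by move=> i u' [[]].
have := @track_proj n h u tv tv'; rewrite pGv pv' => ->; last first.
  by move=> i x lein; case: (Qu i lein).
by rewrite -tf_based -u0 lift_end_map.
Qed.

Lemma chain_realized u n : homotopy_chain (fun=> equivariant_hom) u n ->
  u 0 = tf -> u n = act_tf -> realized varpi.
Proof.
move=> [Qu uu] u0 un.
(* [s] is only a set-theoretic section; by equivariance [k] does not depend on it. *)
have [s sK] := choice (covering2_surj tv covG connG).
pose k (z : G * 'I_n.+1) := pH (u z.2 (s z.1)).
have kE i x : i <= n -> pH (u i x) = k (pG x, inord i).
  move=> lein; rewrite /k/= inordK//.
  by apply: equivariant_hom_proj; [exact: Qu|rewrite sK].
have uadj i j : i <= n -> j <= n -> i <= j.+1 -> j <= i.+1 ->
    adjacent_maps (u i) (u j).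
  move=> lein lejn; rewrite leq_eqVlt => /predU1P[ij _|].
    by rewrite ij in lein *; exact/adjacent_maps_sym/uu.
  rewrite ltnS leq_eqVlt => /predU1P[-> _|ltij leji]; first by case: (Qu j).
  have ji : j = i.+1 by apply/eqP; rewrite eqn_leq leji ltij.
  by rewrite ji in lejn *; exact: uu.
have k_adj (z z' : prod_graph G (interval_graph n)) : adj z z' -> adj (k z) (k z').
  case: z z' => [x i] [y j] /andP[/= xy /andP[ij ji]]; rewrite /k /=.
  (* [s x] and [s y] need not be adjacent, so [s y] is replaced by the neighbour of [s x] in the
     same fibre. *)
  rewrite -{1}[x]sK in xy; have [sxy py] := lift_stepP covG xy.
  have -> : pH (u j (s y)) = pH (u j (lift_step pG (s x) y)).
    by apply: equivariant_hom_proj; [exact/Qu/leq_ord|rewrite sK].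
  by apply/hom_adj/uadj => //; exact: leq_ord.
have [v' vv'] := exists_neighbour connG edgeG v.
have vv0 : adj (pG tv) v' by rewrite pGv.
have [tvv' pv'] := lift_stepP covG vv0; set tv' := lift_step _ _ _ in tvv' pv'.
have [|pt lt] := @track_path (fun=> equivariant_hom) u n tv tv' _ (conj Qu uu) tvv'.
  by move=> i u' [].
have := @track_proj n k u tv tv'; rewrite pGv pv' => /(_ (fun i x => kE i x)) tE.
set t := flatten _ in pt lt tE.
rewrite u0 tf_based in pt lt.
have ct : closed_walk (f v) (track k v v').
  rewrite tE; apply: (closed_walk_proj univH pt).
  by rewrite lt un /act_tf (act_proj univH) tf_based.
exists n, (Hom k_adj); split.
  move=> x; rewrite /= /k /= u0 un /act_tf (act_proj univH) tf_lift sK.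
  by split.
exists v', (Sub _ ct); split=> //.
(* By freeness it suffices that [varpi] and the class of the track move [tw] to the same point. *)
apply: (act_eq univH (x := tw)); rewrite (act_base univH) /= tE lift_end_map//.
by rewrite lt un /act_tf tf_based.
Qed.

(** * Chains and the connected component of [tf] *)

Lemma chain_poset_component (R : realType) u n :
  homotopy_chain (fun=> equivariant_hom) u n ->
  poset_component R (@multihom_le tG tH) (multihom_equiv f v tv pG tw pH)
    (singletons (u 0)) (singletons (u n)).
Proof.
have le_refl (eta : tG -> set tH) : multihom_le eta eta by move=> x.
elim: n => [[/(_ 0 (leqnn 0)) u0 _]|n IHn [Qu uu]].
  by apply: poset_component_le => //; exact: multihom_equiv_singletons.
have {}IHn := IHn (conj (fun i lein => Qu i (leqW lein))
  (fun i ltin => uu i (leqW ltin))).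
have pP : multihom_equiv f v tv pG tw pH (fun x => [set u n x; u n.+1 x]).
  by apply: multihom_equiv_pair; [exact: Qu|exact: Qu|exact: uu].
apply: poset_component_trans IHn _.
(* The pair is a common upper bound of the two consecutive singletons. *)
apply: (@poset_component_trans _ _ _ _ _ (fun x => [set u n x; u n.+1 x])).
  apply: poset_component_le => //.
  exact/multihom_equiv_singletons/Qu.
apply: poset_component_sym; apply: poset_component_le => //.
  exact/multihom_equiv_singletons/Qu.
Qed.

Lemma poset_component_chain (R : realType) u' :
  poset_component R (@multihom_le tG tH) (multihom_equiv f v tv pG tw pH)
    (singletons tf) (singletons u') ->
  exists u n, [/\ homotopy_chain (fun=> equivariant_hom) u n,
    u 0 = tf & u n = u'].
Proof.
move=> tfu'; pose C (eta : tG -> set tH) := exists u n,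
  [/\ homotopy_chain (fun=> equivariant_hom) u n, u 0 = tf
    & forall x, eta x (u n x)].
suff : C (singletons u').
  by case=> u [n [cu u0 un]]; exists u, n; split=> //; apply/funext => x; exact: un.
apply: (poset_component_closed _ tfu'); last first.
  by exists (fun=> tf : tG -> tH), 0; split=> //; split.
move=> eta eta' Peta [[_ adj'] _] le_eta; split=> -[u [n [cu u0 un]]].
  by exists u, n; split=> // x; exact/le_eta/un.
(* Going down from [eta'] to [eta], the chain is extended by a selection [w] of [eta]; it is
   adjacent to [u n] because both are selections of [eta']. *)
have [w w_eq wP] := equivariant_selection Peta.
have unw : adjacent_maps (u n) w.
  move=> x y xy; apply: (adj' x y xy (u n x, w y)).
  by split; [exact: un|exact/le_eta/wP].
have [z [cz z0 zn]] := homotopy_chain_rcons cu unw w_eq.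
by exists z, n.+1; split=> //; [rewrite z0|rewrite zn].
Qed.

End EquivariantHomotopy.

Theorem theorem5p1 (R : realType) (G H : graph)
  (finG : finite_set [set: G]) (finH : finite_set [set: H])
  (connG : connected_graph G) (connH : connected_graph H)
  (edgeG : @edges G !=set0) (edgeH : @edges H !=set0)
  (f : hom G H) (v : G)
  (tG : graph) (tv : tG) (pG : hom tG G)
  (univG : universal_covering2 tv v pG)
  (tH : graph) (tw : tH) (pH : hom tH H)
  (univH : universal_covering2 tw (f v) pH)
  (tf : hom tG tH) (tf_based : tf tv = tw)
  (tf_lift : forall x : tG, pH (tf x) = f (pG x))
  (varpi : pi12 (f v)) :
  realized varpi <->
  poset_component R (@multihom_le tG tH) (multihom_equiv f v tv pG tw pH)
    (singletons tf) (singletons (fun x : tG => act tw pH varpi (tf x))).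
Proof.
split=> [/(realized_chain univG univH connG edgeG tf_based tf_lift)|].
  move=> [u [n [cu u0 un]]]; rewrite -un -u0.
  exact: chain_poset_component.
move=> /(poset_component_chain univG univH connG tf_based tf_lift).
move=> [u [n [cu u0 un]]].
exact: (chain_realized univG univH connG edgeG tf_based tf_lift cu u0 un).
Qed.
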